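(* Let $Q$ be a Dyck path of semilength $n$ with $k$ factors $F_1,\ldots,F_k$, where $F_i$ has semilength $f_i$ for $i=1,\ldots,k$. Then the number of Dyck paths covering $Q$ in the Dyck pattern poset is $$1+\sum_{i=1}^{k} f_i^2+\sum_{1\le i<j\le k} f_i f_j.$$
   Context: A Dyck path of semilength $n$ is a word of length $2n$ on the alphabet $\{U,D\}$ with $n$ letters $U$ and $n$ letters $D$ in which every prefix contains at least as many $U$'s as $D$'s. Equivalently, it is a lattice path with steps $U=(1,1)$ and $D=(1,-1)$ from the origin to the $x$-axis never going below the $x$-axis. The Dyck pattern poset is the set of all Dyck paths (including the empty path) with $P\le Q$ if and only if $P$ is a (not necessarily contiguous) subword, i.e. subsequence, of $Q$. It is ranked, with the rank of a path equal to its semilength. A path $P$ covers $Q$ if $Q\le P$ and $\mathrm{rank}(Q)=\mathrm{rank}(P)-1$. If $p_0,p_1,\ldots,p_k$ are the points of $Q$ lying on the $x$-axis, listed from left to right, then the factors of $Q$ are the $k$ Dyck subpaths $F_1,\ldots,F_k$, with $F_i$ going from $p_{i-1}$ to $p_i$. *)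

(* Defs.v *)
From HB Require Import structures.
From mathcomp Require Import all_boot all_order finmap.

Set Implicit Arguments.
Unset Strict Implicit.
Unset Printing Implicit Defensive.

(* A word on {U, D} is a [seq bool]. *)
Definition U : bool := true.
Definition D : bool := false.

Definition is_dyck (w : seq bool) : bool :=
  (count_mem U w == count_mem D w) &&
  all (fun i => count_mem D (take i w) <= count_mem U (take i w))
      (iota 0 (size w).+1).

Record dyck_path := DyckPath { word :> seq bool; _ : is_dyck word }.

HB.instance Definition _ := [isSub for word].
HB.instance Definition _ := [Choice of dyck_path by <:].

Definition semilength (w : seq bool) : nat := (size w)./2.

Definition pattern_le (P Q : dyck_path) : bool := subseq P Q.

Lemma pattern_le_refl : reflexive pattern_le.
Proof. by move=> P; apply: subseq_refl. Qed.

Lemma pattern_le_anti : antisymmetric pattern_le.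
Proof.
move=> P Q /andP[sPQ sQP]; apply: val_inj => /=.
have [le_PQ eq_PQ] := size_subseq_leqif sPQ.
by apply/eqP; rewrite -eq_PQ eqn_leq le_PQ size_subseq.
Qed.

Lemma pattern_le_trans : transitive pattern_le.
Proof. by move=> Q P R; apply: subseq_trans. Qed.

Fact dyck_display : Order.disp_t. Proof. exact: Order.Disp tt tt. Qed.

HB.instance Definition _ :=
  Order.Le_isPOrder.Build dyck_display dyck_path
    pattern_le_refl pattern_le_anti pattern_le_trans.

(* The rank condition is not written [semilength Q = (semilength P).-1]: since
   [0.-1 = 0], the empty path would then cover itself. *)
Definition covers (P Q : dyck_path) : bool :=
  (Q <= P)%O && (semilength P == (semilength Q).+1).

(* The abscissas of the points of the path on the x-axis, from left to right. *)
Definition axis_points (w : seq bool) : seq nat :=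
  [seq i <- iota 0 (size w).+1 | count_mem U (take i w) == count_mem D (take i w)].

Definition factors (w : seq bool) : seq (seq bool) :=
  let p := axis_points w in
  [seq drop ab.1 (take ab.2 w) | ab <- zip p (behead p)].

(* Main.v *)
Require Import Defs.
From mathcomp Require Import all_boot all_order finmap.
From mathcomp Require Import zify.

Set Implicit Arguments.
Unset Strict Implicit.
Unset Printing Implicit Defensive.

(** A cover of [Q] is a Dyck word obtained by inserting one [U] and one [D] in
    [Q]; its leftmost embedding of [Q] is the unique such description in which
    [U] is inserted in front of a [D] of [Q], and [D] in front of a [U] of [Q],
    unless they come after the end of [Q]. Inserting [U] to the left of [D]
    always gives a Dyck word, whereas inserting [D] to the left of [U] does if
    and only if both letters lie strictly inside the same factor. Hence each
    pair made of a [D] and a [U] of the same factor gives one cover, whatever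
    their order, except that no [D] can be inserted in front of the
    initial [U] of the factor; this deficit of [f_i] is made up by the covers in which
    [U] is inserted in the factor and [D] after the end of [Q]. A [D] of one
    factor and a [U] of a later one also give one cover. The last cover is
    [Q] followed by [UD]. *)

(** * Letter counts and heights *)

Definition ups (w : seq bool) : nat := count_mem U w.
Definition downs (w : seq bool) : nat := count_mem D w.
Arguments ups : simpl never.
Arguments downs : simpl never.

Lemma ups_cons b w : ups (b :: w) = b + ups w. Proof. by case: b. Qed.
Lemma downs_cons b w : downs (b :: w) = ~~ b + downs w. Proof. by case: b. Qed.
Lemma ups_cat v w : ups (v ++ w) = ups v + ups w. Proof. exact: count_cat. Qed.
Lemma downs_cat v w : downs (v ++ w) = downs v + downs w.
Proof. exact: count_cat. Qed.

Definition stepsE := (ups_cons, downs_cons, ups_cat, downs_cat).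

Lemma size_steps w : size w = ups w + downs w.
Proof. by elim: w => [|[] w IH] //; rewrite !stepsE /=; lia. Qed.

(** Carrying the current height [h] turns the prefix condition of [is_dyck] into a recursion on the
    word. *)
Fixpoint nonneg_from (h : nat) (w : seq bool) : bool :=
  if w is b :: w' then
    if b then nonneg_from h.+1 w' else (0 < h) && nonneg_from h.-1 w'
  else true.

Lemma nonneg_fromP h w :
  nonneg_from h w =
  all (fun i => downs (take i w) <= h + ups (take i w)) (iota 0 (size w).+1).
Proof.
elim: w h => [|b w IH] h //.
have all_iotaS (p : pred nat) n :
    all p (iota 0 n.+1) = p 0 && all (p \o S) (iota 0 n).
  by rewrite [all _ _]/= (iotaDl 1) all_map.
rewrite all_iotaS leq_addl andTb (eq_all (a2 := fun i =>
  ~~ b + downs (take i w) <= h + (b + ups (take i w)))); last first.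
  by move=> i; rewrite /= !stepsE.
rewrite [nonneg_from _ _]/=; case: b; last case: h => [|h].
- by rewrite IH; apply: eq_all => i /=; lia.
- by rewrite all_iotaS take0.
- by rewrite IH; apply: eq_all => i /=; lia.
Qed.

Lemma is_dyckE w : is_dyck w = (ups w == downs w) && nonneg_from 0 w.
Proof. by rewrite /is_dyck nonneg_fromP. Qed.

(** * First returns to the axis *)

(* [v], started at height [h], reaches height 0 at its end and not before. *)
Fixpoint first_return (h : nat) (v : seq bool) : bool :=
  if v is b :: v' then (0 < h) && first_return (if b then h.+1 else h.-1) v'
  else h == 0.

Lemma first_return_count h v :
  first_return h v -> downs v = h + ups v.
Proof.
elim: v h => [|b v IH] h /=; first by move/eqP->.
by case/andP=> h_gt0 /IH; rewrite !stepsE; case: b; lia.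
Qed.

Lemma first_return_lt h v i :
  first_return h v -> i < size v ->
  downs (take i v) < h + ups (take i v).
Proof.
elim: v h i => [|b v IH] h [|i] //= /andP[h_gt0 rv]; first by rewrite addn0.
by rewrite ltnS => /(IH _ _ rv); rewrite !stepsE; case: (b) h_gt0; lia.
Qed.

Lemma first_return_nonneg h v w :
  first_return h v -> nonneg_from h (v ++ w) = nonneg_from 0 w.
Proof.
by elim: v h => [|[] v IH] h /=; [move/eqP->|case/andP=> _ /IH|case/andP=> -> /IH].
Qed.

Lemma first_return_split h w :
    nonneg_from h w -> downs w = h + ups w ->
  exists v w', w = v ++ w' /\ first_return h v.
Proof.
elim: w h => [|b w IH] [|h].
- by exists [::], [::].
- by [].
- by exists [::], (b :: w).
move=> nw; rewrite !stepsE => cw.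
have [||v [w' [-> rv]]] := IH (if b then h.+2 else h).
- by case: b nw {cw}.
- by case: b cw {nw}; lia.
by exists (b :: v), w'; split=> //=; case: b rv {nw cw}.
Qed.

Lemma axis_points_head w :
  axis_points w =
  0 :: [seq i <- iota 1 (size w) | ups (take i w) == downs (take i w)].
Proof. by rewrite /axis_points /= take0. Qed.

(** Strictly inside [U :: v] the height is positive, so the origin is followed by the end of [v],
    from which the points of [w] recur, shifted. *)
Lemma axis_points_cat v w :
  first_return 1 v ->
  axis_points (U :: v ++ w) =
  0 :: [seq (size v).+1 + i | i <- axis_points w].
Proof.
move=> rv; rewrite axis_points_head; congr cons.
have -> : size (U :: v ++ w) = size v + (size w).+1.
  by rewrite /= size_cat addnS.
rewrite iotaD filter_cat (_ : filter _ (iota 1 _) = [::]) ?cat0s; last first.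
  apply/eqP; rewrite -[_ == _]negbK -has_filter; apply/hasPn => -[|i];
    rewrite mem_iota //; case/andP=> _ lt_i.
  have lt_iv : i < size v by lia.
  have lt_down := first_return_lt rv lt_iv.
  rewrite /= take_cat lt_iv -/(ups _) -/(downs _) !stepsE /U; lia.
have cv := first_return_count rv.
rewrite (_ : 1 + size v = (size v).+1 + 0); last by lia.
rewrite iotaDl filter_map; congr map; apply: eq_filter => i /=.
rewrite take_cat ltnNge leq_addr /= addKn -/(ups _) -/(downs _) !stepsE /U cv; lia.
Qed.

Lemma zip_map_both (S T : Type) (g : S -> T) (s t : seq S) :
  zip (map g s) (map g t) = [seq (g ab.1, g ab.2) | ab <- zip s t].
Proof. by elim: s t => [|x s IH] [|y t] //=; rewrite IH. Qed.

Lemma factors_cat v w :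
  first_return 1 v -> factors (U :: v ++ w) = (U :: v) :: factors w.
Proof.
move=> rv; rewrite /factors axis_points_cat // axis_points_head.
set r := filter _ _; rewrite [behead (0 :: r)]/=.
have -> : zip (0 :: map (addn (size v).+1) (0 :: r))
              (behead (0 :: map (addn (size v).+1) (0 :: r))) =
    (0, (size v).+1) ::
    [seq ((size v).+1 + ab.1, (size v).+1 + ab.2) | ab <- zip (0 :: r) r].
  by rewrite -zip_map_both /= addn0.
rewrite map_cons /= take_size_cat // -map_comp; congr cons.
apply: eq_map => -[a b] /=.
by rewrite take_cat ltnNge leq_addr /= addKn drop_cat ltnNge leq_addr addKn.
Qed.

(** * Words obtained by inserting letters *)

(* [a] is never inserted in front of an [a], so that no word occurs twice. *)
Fixpoint insert1 (a : bool) (w : seq bool) : seq (seq bool) :=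
  if w is b :: w' then
    (if a == b then [::] else [:: a :: w]) ++ [seq b :: P | P <- insert1 a w']
  else [:: [:: a]].

(** A word starting with [a] matches it with the [a] of the path; otherwise it starts with the
    inserted [~~ a], and [a] is still to be inserted. *)
Fixpoint insertUD (w : seq bool) : seq (seq bool) :=
  if w is a :: w' then
    [seq a :: P | P <- insertUD w'] ++ [seq ~~ a :: P | P <- insert1 a w]
  else [:: [:: U; D]; [:: D; U]].

Lemma mem_map_cons (b c : bool) (s : seq (seq bool)) P :
  (c :: P \in [seq b :: R | R <- s]) = (c == b) && (P \in s).
Proof.
apply/mapP/andP => [[R sR [-> ->]]|[/eqP-> sP]]; first by rewrite eqxx.
by exists P.
Qed.

Lemma nil_notin_map_cons (b : bool) (s : seq (seq bool)) :
  ([::] \in [seq b :: R | R <- s]) = false.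
Proof. by apply/mapP => -[]. Qed.

Lemma mem_insert1 (a : bool) w P :
  (P \in insert1 a w) =
  [&& subseq w P, ups P == a + ups w & downs P == ~~ a + downs w].
Proof.
elim: w P => [|b w IH] [|c P].
- by case: a.
- rewrite sub0seq inE eqseq_cons.
  by case: a c P => [] [] [|[] P]; rewrite ?stepsE /= ?andbF ?eqxx.
- by rewrite /= mem_cat nil_notin_map_cons orbF; case: (a == b); rewrite ?inE.
rewrite [insert1 _ _]/= mem_cat mem_map_cons IH.
have [->|neq_cb] := eqVneq c b.
  rewrite /= eqxx (_ : _ \in _ = false) /=; last first.
    by case: (eqVneq a b) => //= neq_ab; rewrite inE eqseq_cons eq_sym (negPf neq_ab).
  by rewrite !stepsE; congr (_ && _); lia.
rewrite [subseq _ (c :: P)]/= (eq_sym b) (negPf neq_cb) /= orbF.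
have [eq_ab|neq_ab] := eqVneq a b.
  (* The extra letter is [a = b], so [P] has one [c] fewer than [b :: w] and cannot contain it. *)
  rewrite in_nil; apply/esym/negP => /and3P[sP].
  have := leq_count_subseq (pred1 U) sP; have := leq_count_subseq (pred1 D) sP.
  rewrite -!/(ups _) -!/(downs _) !stepsE.
  by case: a b c eq_ab neq_cb {IH sP} => [] [] [] //= _ _; lia.
have eq_ca : c = a by case: a b c neq_ab neq_cb {IH} => [] [] [].
rewrite inE eqseq_cons eq_ca eqxx !(stepsE, eqn_add2l) eq_sym /=.
apply/eqP/and3P => [<-|[sP uP dP]]; first by rewrite !stepsE !eqxx.
apply/eqP; rewrite -(size_subseq_leqif sP) !size_steps !stepsE.
by lia.
Qed.

Lemma mem_insertUD w P :
  (P \in insertUD w) =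
  [&& subseq w P, ups P == (ups w).+1 & downs P == (downs w).+1].
Proof.
elim: w P => [|a w IH] [|b P] //.
- by case: b P => [] [|[] [|[] P]]; rewrite !inE !eqseq_cons !stepsE /= ?andbF ?eqxx.
- by rewrite [insertUD _]/= mem_cat !nil_notin_map_cons.
rewrite [insertUD _]/= -/(insert1 a (a :: w)) mem_cat !mem_map_cons IH mem_insert1.
rewrite [subseq _ (b :: P)]/= !stepsE.
by case: a b => [] [] /=; rewrite ?orbF; congr (_ && _); lia.
Qed.

Lemma uniq_insert1 a w : uniq (insert1 a w).
Proof.
elim: w => //= b w IH; have uw : uniq [seq b :: P | P <- insert1 a w].
  by rewrite map_inj_uniq // => P R [].
by have [//|neq_ab] := eqVneq a b; rewrite /= uw mem_map_cons (negPf neq_ab).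
Qed.

Lemma uniq_insertUD w : uniq (insertUD w).
Proof.
elim: w => [//|a w IH]; rewrite [insertUD _]/= -/(insert1 a (a :: w)) cat_uniq.
rewrite !map_inj_uniq ?uniq_insert1 ?IH /= ?andbT; try by move=> P R [].
apply/hasPn => P /mapP[R _ ->]; rewrite mem_map_cons.
by case: (a).
Qed.

(** * Counting the insertions that stay nonnegative *)

Lemma size_insert1_D w : size (insert1 D w) = (ups w).+1.
Proof.
by elim: w => [|b w IH] //; rewrite /= size_cat size_map IH; case: b.
Qed.

Lemma insert1_D_nonneg h w P :
  nonneg_from h w -> P \in insert1 D w -> nonneg_from h.+1 P.
Proof.
elim: w h P => [|b w IH] h P; first by rewrite inE => _ /eqP->.
rewrite [insert1 _ _]/= mem_cat => nw /orP[|/mapP[R sR ->]].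
  by case: b nw => //= nw; rewrite inE => /eqP->.
by case: b nw => /= [|/andP[]]; [|case: h => // h _] => /IH; apply.
Qed.

(* Started one unit too low, [v] goes below the axis at its final [D], unless
   [U] is inserted before; there is one insertion in front of each [D]. *)
Lemma count_insert1_U h v w :
    first_return h.+1 v -> nonneg_from 0 w ->
  count (nonneg_from h) (insert1 U (v ++ w)) = downs v.
Proof.
move=> + nw; elim: v h => [|[] v IH] h // rv.
  by rewrite /= count_map stepsE -(IH h.+1).
rewrite [insert1 _ _]/= [count _ _]/= count_map stepsE; congr (_ + _).
  by have := first_return_nonneg w rv; rewrite nw /= => ->.
(* If [h = 0], this [D] is the final one: [v] is empty, and a word that keeps [D] in front goes
   below the axis. *)
case: h rv => [|h] rv; last by rewrite -(IH h).
by case: v {IH} rv => // _; rewrite /= (eq_count (a2 := pred0)) ?count_pred0.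
Qed.

(** Each [D] of [v] pairs with each [U] of [v] or [w] and with the end. A [D] inserted in [v] needs
    a [U] inserted in [v] too, so only the pairs inside [w] remain. *)
Lemma count_insertUD h v w :
    first_return h v -> nonneg_from 0 w ->
  count (nonneg_from h) (insertUD (v ++ w)) =
  count (nonneg_from 0) (insertUD w) +
  downs v * (ups v + (ups w).+1).
Proof.
move=> + nw; elim: v h => [|b v IH] h; first by move/eqP->; rewrite addn0.
case: h => // h rv; rewrite [insertUD _]/= count_cat -/(insert1 b (b :: v ++ w)).
rewrite !count_map !stepsE; case: b rv => rv.
  rewrite (eq_count (a2 := nonneg_from h.+2)) // (IH h.+2) //.
  rewrite -addnA; congr (_ + _).
  rewrite [insert1 _ _]/= count_map.
  rewrite (eq_count (a2 := nonneg_from h.+1)) // (count_insert1_U (h := h.+1)) //.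
  by lia.
rewrite (eq_count (a2 := nonneg_from h)) // (IH h) //.
rewrite [insert1 _ _]/= count_map.
(* With [U] put in front of this [D], every insertion of [D] further on is allowed. *)
have /eqP -> : count (preim (cons false) (preim (cons (~~ false)) (nonneg_from h.+1)))
          (insert1 false (v ++ w)) == size (insert1 D (v ++ w)).
  rewrite -all_count; apply/allP => P sP.
  by apply: insert1_D_nonneg sP; rewrite (first_return_nonneg (v := v) w rv).
rewrite size_insert1_D ups_cat.
by lia.
Qed.

(** * Summation over the factors *)

Definition factor_sum (s : seq nat) : nat :=
  \sum_(i < size s) nth 0 s i ^ 2 +
  \sum_(i < size s) \sum_(j < size s | i < j) nth 0 s i * nth 0 s j.

Lemma factor_sum_cons x s : factor_sum (x :: s) = factor_sum s + x * (x + sumn s).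
Proof.
rewrite /factor_sum /= !big_ord_recl /=.
have -> : \sum_(j < (size s).+1 | 0 < j) x * nth 0 (x :: s) j = x * sumn s.
  rewrite big_mkcond big_ord_recl /= add0n sumnE (big_nth 0) big_mkord big_distrr.
  by apply: eq_bigr.
have -> : \sum_(i < size s)
     \sum_(j < (size s).+1 | bump 0 i < j) nth 0 s i * nth 0 (x :: s) j =
   \sum_(i < size s) \sum_(j < size s | i < j) nth 0 s i * nth 0 s j.
  apply: eq_bigr => i _.
  by rewrite big_mkcond big_ord_recl /= add0n [RHS]big_mkcond.
by rewrite mulnDr mulnn addnACA addnC.
Qed.

Lemma count_dyck_insertUD w :
  is_dyck w ->
  ups w = sumn (map semilength (factors w)) /\
  count (nonneg_from 0) (insertUD w) =
    1 + factor_sum (map semilength (factors w)).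
Proof.
have [m] := ubnP (size w); elim: m w => [//|m IH] [|b w] lt_wm.
  (* Of [UD] and [DU] only the former is nonnegative: this is the summand 1. *)
  by rewrite /= /factor_sum !big_ord0.
rewrite is_dyckE => /andP[/eqP]; rewrite !stepsE.
case: b lt_wm => //= lt_wm cw nw.
have [|v [w' [def_w rv]]] := first_return_split nw; first by rewrite cw.
have cv := first_return_count rv.
have dw' : is_dyck w'.
  rewrite is_dyckE -(first_return_nonneg w' rv) -def_w nw andbT.
  by move: cw; rewrite def_w !stepsE; lia.
have [|cU cnt] := IH w' _ dw'.
  by move: lt_wm; rewrite def_w /= size_cat; lia.
have size_v : semilength (U :: v) = downs v.
  by rewrite /semilength size_steps !stepsE /U cv; lia.
rewrite def_w factors_cat // map_cons factor_sum_cons size_v /= -cU.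
have nw' : nonneg_from 0 w' by move: dw'; rewrite is_dyckE => /andP[].
split; first by rewrite ups_cat cv; lia.
(* A [D] in front of the initial [U] goes below the axis at once. *)
rewrite count_cat !count_map [X in _ + X](eq_count (a2 := pred0)) // count_pred0.
rewrite (eq_count (a2 := nonneg_from 1)) // (count_insertUD _ nw') // cnt.
(* The initial [U] of the factor, missing from [ups v], is offset by the insertion of [D] at the
   end. *)
by rewrite cv; lia.
Qed.

Lemma insertUD_covers (P Q : dyck_path) : (val P \in insertUD Q) = covers P Q.
Proof.
rewrite mem_insertUD /covers /semilength !size_steps.
case: P Q => [P dP] [Q dQ] /=; rewrite [(_ <= _)%O]/=; congr (_ && _).
by move: dP dQ; rewrite !is_dyckE => /andP[/eqP-> _] /andP[/eqP-> _]; lia.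
Qed.

Theorem proposition2p2 (n k : nat) (Q : dyck_path) (F : k.-tuple (seq bool))
    (f : 'I_k -> nat)
    (hQ : semilength Q = n)
    (hF : factors Q = F)
    (hf : forall i : 'I_k, semilength (tnth F i) = f i) :
  exists A : {fset dyck_path},
    (forall P : dyck_path, (P \in A) = covers P Q) /\
    #|` A|%fset =
      1 + \sum_(i < k) f i ^ 2 + \sum_(i < k) \sum_(j < k | i < j) f i * f j.
Proof.
pose s : seq dyck_path := pmap insub (insertUD Q).
exists [fset P in s]%fset; split=> [P|].
  by rewrite !inE /= mem_pmap_sub insertUD_covers.
rewrite card_fseq undup_id ?pmap_sub_uniq ?uniq_insertUD // size_pmap_sub.
have dQ : is_dyck Q by case: (Q).
have [_ cnt] := count_dyck_insertUD dQ.
(* All words of [insertUD Q] are balanced, so only nonnegativity is left to test. *)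
have -> : count is_dyck (insertUD Q) = count (nonneg_from 0) (insertUD Q).
  apply: eq_in_count => P; rewrite mem_insertUD is_dyckE => /and3P[_ /eqP-> /eqP->].
  by move: dQ; rewrite is_dyckE => /andP[/eqP-> _]; rewrite eqxx.
have fE (i : 'I_k) : nth 0 [seq semilength v | v <- F] i = f i.
  by rewrite (nth_map [::]) ?size_tuple // -hf (tnth_nth [::]).
rewrite cnt hF /factor_sum size_map size_tuple addnA.
congr (_ + _ + _); first by apply: eq_bigr => i _; rewrite fE.
by apply: eq_bigr => i _; apply: eq_bigr => j _; rewrite !fE.
Qed.
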